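(* Let $N\geq 4$ be an integer and let $F_N$ be the free group of rank $N$. There exists an infinite family $\{\varphi_k \mid k\in\mathbb{N}\}$ of automorphisms of $F_N$, each of which has a parabolic orbit in $\partial F_N$, such that for all $k,k',p,p'\in\mathbb{N}$, the automorphisms $\varphi_k^{p}$ and $\varphi_{k'}^{p'}$ are conjugate in $\mathrm{Aut}(F_N)$ if and only if $k=k'$ and $p=p'$.
   Context: Here $\mathbb{N}=\{1,2,3,\dots\}$. $\partial F_N$ denotes the Gromov boundary of $F_N$: having fixed a basis of $F_N$, it is the set of right-infinite reduced words in the basis elements and their inverses, with the topology generated by the cylinders (sets of infinite reduced words having a given finite prefix). Any $\varphi\in\mathrm{Aut}(F_N)$ induces a homeomorphism $\partial\varphi$ of $\partial F_N$. An automorphism $\varphi\in\mathrm{Aut}(F_N)$ has a parabolic orbit if there exist points $X\neq Y$ in $\partial F_N$ such that $\lim_{k\to+\infty}\partial\varphi^{k}(Y)=X$ and $\lim_{k\to-\infty}\partial\varphi^{k}(Y)=X$. *)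

(* Defs.v *)
From HB Require Import structures.
From mathcomp Require Import all_boot.
From mathcomp Require Import all_classical.
From mathcomp Require Import topology.

Set Implicit Arguments.
Unset Strict Implicit.
Unset Printing Implicit Defensive.

Import Algebra.
Local Open Scope classical_set_scope.
Local Open Scope group_scope.

(* The letter (i, false) is the i-th basis element, (i, true) its inverse. *)
Notation letter N := ('I_N * bool)%type.

Definition linv N (a : letter N) : letter N := (a.1, ~~ a.2).

Lemma linvK N : involutive (@linv N).
Proof. by case=> i b; rewrite /linv /= negbK. Qed.

Definition no_cancel N : rel (letter N) := fun a b => b != linv a.

Lemma no_cancel_linv N (a b : letter N) :
  no_cancel (linv a) (linv b) = no_cancel b a.
Proof.
by rewrite /no_cancel linvK eq_sym.
Qed.

Definition reduced N (w : seq (letter N)) : bool := sorted (@no_cancel N) w.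

Record free_group (N : nat) :=
  FreeWord { word :> seq (letter N); word_reduced : reduced word }.
HB.instance Definition _ N := [isSub for @word N].
HB.instance Definition _ N := [Choice of free_group N by <:].

Section FreeGroup.
Variable N : nat.
Implicit Types (a b : letter N) (u v w : seq (letter N)).

Definition lcons a w : seq (letter N) :=
  if w is b :: w' then if b == linv a then w' else a :: w else [:: a].

(* If v is reduced, lcat u v is the reduced form of the concatenation u ++ v. *)
Definition lcat u v : seq (letter N) := foldr lcons v u.

Definition winv w : seq (letter N) := rev (map (@linv N) w).

Lemma reduced_behead a w : reduced (a :: w) -> reduced w.
Proof. by case: w => //= b w /andP[]. Qed.

Lemma reduced_lcons a w : reduced w -> reduced (lcons a w).
Proof.
case: w => //= b w wr; case: ifPn => [_|nab]; first exact: reduced_behead wr.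
by rewrite /= /no_cancel nab.
Qed.

Lemma reduced_lcat u v : reduced v -> reduced (lcat u v).
Proof. by move=> vr; elim: u => //= a u; apply: reduced_lcons. Qed.

Lemma reduced_winv w : reduced w -> reduced (winv w).
Proof.
rewrite /reduced /winv rev_sorted sorted_map => wr.
by rewrite (eq_sorted (e' := @no_cancel N)) // => a b; rewrite /= no_cancel_linv.
Qed.

Lemma reduced_take n w : reduced w -> reduced (take n w).
Proof. exact: take_sorted. Qed.

Lemma lcons_reduced a w : reduced (a :: w) -> lcons a w = a :: w.
Proof. by case: w => //= b w /andP[]; rewrite /no_cancel => /negPf ->. Qed.

Lemma lconsK a w : reduced w -> lcons (linv a) (lcons a w) = w.
Proof.
case: w => [|b w] wr /=; first by rewrite linvK eqxx.
case: eqP => [eb|_] /=; last by rewrite linvK eqxx.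
by move: wr; rewrite eb => /lcons_reduced.
Qed.

Lemma lcat_lcons a u v : reduced u -> reduced v ->
  lcat (lcons a u) v = lcons a (lcat u v).
Proof.
case: u => //= b u bur vr; case: eqP => //= ->.
by rewrite -{1}(linvK a) lconsK // reduced_lcat.
Qed.

Lemma lcatA u v w : reduced u -> reduced v -> reduced w ->
  lcat u (lcat v w) = lcat (lcat u v) w.
Proof.
move=> ur vr wr; elim: u ur => //= a u IHu aur.
by rewrite lcat_lcons ?reduced_lcat // IHu //; apply: reduced_behead aur.
Qed.

Lemma lcatw0 u : reduced u -> lcat u [::] = u.
Proof.
elim: u => //= a u IHu aur; rewrite IHu ?lcons_reduced //.
exact: reduced_behead aur.
Qed.

Lemma lcatV w : lcat (winv w) w = [::].
Proof.
elim: w => // a w IHw.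
by rewrite /winv map_cons rev_cons /lcat foldr_rcons /= linvK eqxx.
Qed.

Lemma winvK : involutive winv.
Proof.
move=> w; rewrite /winv map_rev revK -map_comp -[RHS]map_id.
by apply: eq_map => a /=; rewrite linvK.
Qed.

Definition fg_one : free_group N := @FreeWord N [::] isT.
Definition fg_mul (x y : free_group N) : free_group N :=
  FreeWord (reduced_lcat x (word_reduced y)).
Definition fg_inv (x : free_group N) : free_group N :=
  FreeWord (reduced_winv (word_reduced x)).

Lemma fg_mulA : associative fg_mul.
Proof. by move=> x y z; apply/val_inj/lcatA; apply: word_reduced. Qed.

Lemma fg_mul1 : left_id fg_one fg_mul.
Proof. by move=> x; apply/val_inj. Qed.

Lemma fg_mulr1 : right_id fg_one fg_mul.
Proof. by move=> x; apply/val_inj/lcatw0/word_reduced. Qed.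

Lemma fg_mulV : left_inverse fg_one fg_inv fg_mul.
Proof. by move=> x; apply/val_inj/lcatV. Qed.

Lemma fg_mulrV : right_inverse fg_one fg_inv fg_mul.
Proof. by move=> x; apply/val_inj; rewrite /= -{1}[word x]winvK lcatV. Qed.

HB.instance Definition _ := isGroup.Build (free_group N)
  fg_mulA fg_mul1 fg_mulr1 fg_mulV fg_mulrV.
HB.instance Definition _ := isPointed.Build (free_group N) 1.

End FreeGroup.

Section Automorphisms.
Variable G : groupType.

Record aut := MkAut {
  aut_fun :> G -> G;
  _ : `[< {morph aut_fun : x y / x * y} /\ bijective aut_fun >]
}.
HB.instance Definition _ := [isSub for aut_fun].
HB.instance Definition _ := gen_eqMixin aut.
HB.instance Definition _ := gen_choiceMixin aut.

Implicit Types phi psi : aut.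

Lemma autM phi : {morph phi : x y / x * y}.
Proof. by case: phi => f /= /asboolP[]. Qed.

Lemma aut_bij phi : bijective phi.
Proof. by case: phi => f /= /asboolP[]. Qed.

Lemma aut_ext phi psi : phi =1 psi -> phi = psi.
Proof. by move=> /funext; apply: val_inj. Qed.

Fact aut_one_subproof :
  `[< {morph @id G : x y / x * y} /\ bijective (@id G) >].
Proof. by apply/asboolP; split=> //; exists id. Qed.

Definition aut_one : aut := MkAut aut_one_subproof.

Fact aut_mul_subproof phi psi :
  `[< {morph phi \o psi : x y / x * y} /\ bijective (phi \o psi) >].
Proof.
apply/asboolP; split; first by move=> x y /=; rewrite !autM.
exact: bij_comp (aut_bij phi) (aut_bij psi).
Qed.

Definition aut_mul phi psi : aut := MkAut (aut_mul_subproof phi psi).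

Lemma aut_inv_ex phi : exists psi : aut, cancel phi psi /\ cancel psi phi.
Proof.
have [g fK gK] := aut_bij phi.
suff gP : `[< {morph g : x y / x * y} /\ bijective g >] by exists (MkAut gP).
apply/asboolP; split; last by exists phi.
by move=> x y; apply: (can_inj fK); rewrite autM !gK.
Qed.

Definition aut_inv phi : aut := projT1 (cid (aut_inv_ex phi)).

Lemma aut_mulA : associative aut_mul.
Proof. by move=> f g h; apply: aut_ext. Qed.

Lemma aut_mul1 : left_id aut_one aut_mul.
Proof. by move=> f; apply: aut_ext. Qed.

Lemma aut_mulr1 : right_id aut_one aut_mul.
Proof. by move=> f; apply: aut_ext. Qed.

Lemma aut_mulV : left_inverse aut_one aut_inv aut_mul.
Proof.
by move=> f; apply: aut_ext => x; apply: (projT2 (cid (aut_inv_ex f))).1.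
Qed.

Lemma aut_mulrV : right_inverse aut_one aut_inv aut_mul.
Proof.
by move=> f; apply: aut_ext => x; apply: (projT2 (cid (aut_inv_ex f))).2.
Qed.

HB.instance Definition _ := isGroup.Build aut
  aut_mulA aut_mul1 aut_mulr1 aut_mulV aut_mulrV.

Lemma autME phi psi x : (phi * psi) x = phi (psi x).
Proof. by []. Qed.

Lemma aut1E x : (1 : aut) x = x.
Proof. by []. Qed.

Lemma aut_map1 phi : phi 1 = 1.
Proof. by apply: (@mulgI _ (phi 1)); rewrite -autM !mulg1. Qed.

Lemma autK phi : cancel phi (phi^-1)%g.
Proof. by move=> x; rewrite -autME mulVg. Qed.

End Automorphisms.

Definition conjugate (G : groupType) (x y : G) : Prop := exists z : G, x ^ z = y.

Record boundary (N : nat) := MkBoundary {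
  ray :> nat -> letter N;
  _ : `[< forall n, no_cancel (ray n) (ray n.+1) >]
}.
HB.instance Definition _ N := [isSub for @ray N].
HB.instance Definition _ N := gen_eqMixin (boundary N).
HB.instance Definition _ N := gen_choiceMixin (boundary N).

Section Boundary.
Variable N : nat.
Implicit Types (X Y Z : boundary N) (w : free_group N) (phi psi : aut (free_group N)).

Lemma ray_no_cancel X n : no_cancel (X n) (X n.+1).
Proof. by case: X => X /= /asboolP. Qed.

Lemma boundary_ext X Y : X =1 Y -> X = Y.
Proof. by move=> /funext; apply: val_inj. Qed.

Lemma initial_reduced X n : reduced (mkseq X n).
Proof.
case: n => // n; apply/(sortedP (X 0)) => i; rewrite size_mkseq => lt_in.
by rewrite !nth_mkseq ?(ltnW lt_in) // ray_no_cancel.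
Qed.

Definition initial X n : free_group N := FreeWord (initial_reduced X n).

Lemma size_initial X n : size (initial X n) = n.
Proof. exact: size_mkseq. Qed.

Lemma take_initial X m n : (m <= n)%N -> take m (initial X n) = initial X m.
Proof. by move=> le_mn; rewrite /= /mkseq -map_take take_iota (minn_idPl le_mn). Qed.

Lemma initial_inj X Y : initial X =1 initial Y -> X = Y.
Proof.
move=> eqXY; apply: boundary_ext => n.
have /(congr1 (fun w : free_group N => nth (X n) w n)) := eqXY n.+1.
by rewrite /= !nth_mkseq.
Qed.

Definition cylinder w : set (boundary N) := [set X | initial X (size w) = w].

Lemma cylinder_cover : \bigcup_(w in [set: free_group N]) cylinder w = setT.
Proof.
by apply/seteqP; split=> // X _; exists (1 : free_group N) => //; apply: val_inj.
Qed.

Lemma cylinder_join (u v : free_group N) (X : boundary N) :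
  setT u -> setT v -> cylinder u X -> cylinder v X ->
  exists w, [/\ setT w, cylinder w X & cylinder w `<=` cylinder u `&` cylinder v].
Proof.
move=> _ _ uX vX.
have sub n m : (n <= m)%N -> cylinder (initial X m) `<=` cylinder (initial X n).
  move=> le_nm Y; rewrite /cylinder /= !size_mkseq => eqY.
  apply: val_inj; move: (congr1 (fun w : free_group N => take n w) eqY).
  by rewrite !take_initial.
exists (initial X (maxn (size u) (size v))); split=> //.
  by rewrite /cylinder /= size_mkseq.
by move=> Y XY; split; [rewrite -uX | rewrite -vX];
  apply: sub XY; rewrite ?leq_maxl ?leq_maxr.
Qed.

HB.instance Definition _ := isBaseTopological.Build (boundary N)
  cylinder_cover cylinder_join.

Lemma open_cylinder w : open (cylinder w).
Proof. by exists [set w] => //; rewrite bigcup_set1. Qed.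

Lemma nbhs_boundaryP X (A : set (boundary N)) :
  nbhs X A <-> exists n, cylinder (initial X n) `<=` A.
Proof.
rewrite nbhsE; split=> [[B [[D _ <-] [w Dw wX]] sBA]|[n sA]].
  exists (size w); rewrite wX => Y wY; apply: sBA; by exists w.
exists (cylinder (initial X n)) => //.
by split; [exact: open_cylinder | rewrite /cylinder /= size_mkseq].
Qed.

Lemma cvg_boundaryP (F : set_system (boundary N)) {FF : Filter F} X :
  F --> X <-> forall m, \forall Y \near F, initial Y m = initial X m.
Proof.
split=> [cvgF m|cvgF A /nbhs_boundaryP[m sA]].
  apply: cvgF; apply/nbhs_boundaryP; exists m => Y.
  by rewrite /cylinder /= size_mkseq.
by apply: filterS (cvgF m) => Y eqY; apply: sA; rewrite /cylinder /= size_mkseq.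
Qed.

Lemma boundary_hausdorff : hausdorff_space (boundary N).
Proof.
have nbhs_cyl X n : nbhs X (cylinder (initial X n)) by apply/nbhs_boundaryP; exists n.
move=> X Y clXY; apply: initial_inj => n.
have [Z []] := clXY _ _ (nbhs_cyl X n) (nbhs_cyl Y n).
by rewrite /cylinder /= !size_mkseq => ->.
Qed.

Lemma size_lcat (u v : seq (letter N)) :
  (size (lcat u v) <= size u + size v)%N.
Proof.
elim: u => //= a u IHu; apply: leq_trans (_ : (size (lcat u v)).+1 <= _)%N => //.
by case: (lcat u v) => //= b w; case: ifP => //= _; rewrite ltnW.
Qed.

Lemma lcat_take (u v : seq (letter N)) : reduced u ->
  exists k, [/\ (k <= size u)%N, (k <= size v)%N &
    lcat u v = take (size u - k) u ++ drop k v].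
Proof.
elim: u => [|a u IHu] aur; first by exists 0; rewrite drop0.
have [k [le_ku le_kv /= ->]] := IHu (reduced_behead aur).
have [lt_ku|] := ltnP k (size u).
  exists k; split=> //; first exact: ltnW.
  rewrite subSn //=; case: u aur lt_ku {IHu le_ku} => // b u /andP[nab _] lt_ku.
  by rewrite subSn //=; move/negPf: nab => ->.
rewrite leq_eqVlt ltnNge le_ku orbF => /eqP eq_uk.
rewrite eq_uk subnn take0 /=; case Dv: (drop k v) => [|b v'].
  by exists k; rewrite subSnn /= take0 Dv.
have lt_kv : (k < size v)%N by rewrite -subn_gt0 -size_drop Dv.
rewrite /=; case: ifP => _; last by exists k; rewrite subSnn /= take0 Dv.
by exists k.+1; rewrite subnn take0 -add1n -drop_drop Dv /= drop0.
Qed.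

Lemma take_mul m (x y : free_group N) :
  (m + size y <= size x)%N -> take m (x * y)%g = take m x.
Proof.
move=> le_mx; have [k [_ le_ky /= ->]] := lcat_take y (word_reduced x).
have le_mk : (m <= size x - k)%N.
  by rewrite leq_subRL; [rewrite addnC (leq_trans _ le_mx) ?leq_add2l|
    rewrite (leq_trans le_ky) // (leq_trans _ le_mx) ?leq_addl].
by rewrite takel_cat ?take_takel // size_takel // leq_subr.
Qed.

Definition gen (a : letter N) : free_group N := @FreeWord N [:: a] isT.

Definition wtake n w : free_group N := FreeWord (reduced_take n (word_reduced w)).

Lemma wtakeS n w : (n < size w)%N -> exists a, wtake n.+1 w = wtake n w * gen a.
Proof.
move=> lt_nw; have [a0 _] : exists a : letter N, True.
  by case: w lt_nw => [[|a w] ?] // _; exists a.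
exists (nth a0 w n); apply: val_inj.
have tr := reduced_take n.+1 (word_reduced w).
by rewrite /= -[LHS](lcatw0 tr) (take_nth a0) // /lcat foldr_rcons.
Qed.

Definition gen_bound phi : nat := (\max_(a : letter N) size (phi (gen a)))%N.

Lemma size_gen_bound phi a : (size (phi (gen a)) <= gen_bound phi)%N.
Proof. by apply: (leq_bigmax a). Qed.

Lemma size_aut phi w : (size (phi w) <= gen_bound phi * size w)%N.
Proof.
suff step n : (n <= size w)%N -> (size (phi (wtake n w)) <= gen_bound phi * n)%N.
  have -> : w = wtake (size w) w by apply: val_inj; rewrite /= take_size.
  by rewrite /= take_size; apply: step.
elim: n => [_|n IHn lt_nw].
  have -> : wtake 0 w = 1 by apply: val_inj; rewrite /= take0.
  by rewrite aut_map1.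
have [a ->] := wtakeS lt_nw; rewrite autM mulnS addnC.
apply: leq_trans (size_lcat _ _) _.
by rewrite leq_add ?size_gen_bound // IHn // ltnW.
Qed.

(* Long common initial segments are sent to long common initial segments. *)
Lemma aut_take phi m : exists B, forall w n, (B <= n <= size w)%N ->
  (m <= size (phi (wtake n w)))%N /\ take m (phi w) = take m (phi (wtake n w)).
Proof.
pose L := (gen_bound phi^-1).+1.
exists (L * (m + gen_bound phi))%N => w n /andP[le_Bn le_nw].
have big i : (n <= i <= size w)%N ->
    (m + gen_bound phi <= size (phi (wtake i w)))%N.
  case/andP=> le_ni le_iw; rewrite -(leq_pmul2l (ltn0Sn (gen_bound phi^-1))).
  apply: leq_trans (leq_trans le_Bn le_ni) _.
  have := size_aut phi^-1 (phi (wtake i w)); rewrite autK /= (size_takel le_iw).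
  by move/leq_trans; apply; rewrite leq_mul2r leqnSn orbT.
split; first by apply: leq_trans (big n _); rewrite ?leq_addr ?leqnn.
suff step d : (n + d <= size w)%N ->
    take m (phi (wtake (n + d) w)) = take m (phi (wtake n w)).
  have {1}-> : w = wtake (n + (size w - n)) w.
    by apply: val_inj; rewrite /= subnKC // take_size.
  by apply: step; rewrite subnKC.
elim: d => [|d IHd]; first by rewrite addn0.
rewrite addnS => lt_w; have [a ->] := wtakeS lt_w; rewrite autM take_mul.
  by apply: IHd; apply: ltnW.
apply: leq_trans (big (n + d) _); first by rewrite leq_add2l size_gen_bound.
by rewrite leq_addr ltnW.
Qed.

Lemma wtake_initial X m n : (m <= n)%N -> wtake m (initial X n) = initial X m.
Proof. by move=> le_mn; apply: val_inj; exact: take_initial. Qed.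

Lemma boundary_map_ex phi X : exists Y : boundary N,
  forall m, \forall n \near \oo, take m (phi (initial X n)) = initial Y m.
Proof.
have /choice[B BP] := aut_take phi.
have BX m n : (B m <= n)%N -> (m <= size (phi (initial X (B m))))%N /\
    take m (phi (initial X n)) = take m (phi (initial X (B m))).
  move=> le_Bn; rewrite -(wtake_initial X le_Bn).
  by apply: (BP m); rewrite leqnn size_initial.
have [a0 _] : exists a : letter N, True by exists (X 0).
pose Yf m := nth a0 (phi (initial X (B m.+1))) m.
have Ynth m n i : (i < m)%N -> (B m <= n)%N -> nth a0 (phi (initial X n)) i = Yf i.
  move=> lt_im le_Bn; pose M := maxn n (B i.+1).
  have nthM k j : (i < k)%N -> (B k <= j)%N ->
      nth a0 (phi (initial X j)) i = nth a0 (phi (initial X (B k))) i.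
    move=> lt_ik /BX[_ /(congr1 (fun s => nth a0 s i))].
    by rewrite !nth_take.
  rewrite (nthM m n) // -(nthM m M) ?(nthM i.+1 M) ?leq_maxr //.
  exact: leq_trans le_Bn (leq_maxl _ _).
have Yr : `[< forall n, no_cancel (Yf n) (Yf n.+1) >].
  apply/asboolP => n; set k := B n.+2.
  have [big _] := BX n.+2 k (leqnn _).
  rewrite -(Ynth n.+2 k n) // -(Ynth n.+2 k n.+1) //.
  have /(sortedP a0) := word_reduced (phi (initial X k)); exact.
exists (MkBoundary Yr) => m; exists (B m) => // n /= le_Bn.
have [big eqn] := BX m n le_Bn.
have szm : (m <= size (phi (initial X n)))%N.
  by rewrite -[m](size_takel big) -eqn size_take_min geq_minr.
apply: (@eq_from_nth _ a0) => [|i]; rewrite size_takel ?size_mkseq // => lt_im.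
by rewrite nth_take // nth_mkseq //= (Ynth m).
Qed.

(* The homeomorphism of the boundary induced by phi: X is sent to the limit,
   letter by letter, of the reduced words phi (X_0 ... X_(n-1)). *)
Definition boundary_map phi X : boundary N :=
  projT1 (cid (boundary_map_ex phi X)).

Lemma boundary_mapP phi X m :
  \forall n \near \oo, take m (phi (initial X n)) = initial (boundary_map phi X) m.
Proof. exact: (projT2 (cid (boundary_map_ex phi X))). Qed.

Lemma boundary_map_unique phi X Y :
  (forall m, \forall n \near \oo, take m (phi (initial X n)) = initial Y m) ->
  boundary_map phi X = Y.
Proof.
move=> YP; apply: initial_inj => m; apply: val_inj.
have [n [e1 e2]] := filter_ex (filterI (boundary_mapP phi X m) (YP m)).
exact: etrans (esym e1) e2.
Qed.

Lemma boundary_map1 X : boundary_map 1 X = X.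
Proof.
apply: boundary_map_unique => m; exists m => // n /= le_mn.
exact: take_initial.
Qed.

Lemma boundary_map_take phi m : exists B, forall X n, (B <= n)%N ->
  take m (phi (initial X n)) = initial (boundary_map phi X) m.
Proof.
have [B BP] := aut_take phi m; exists B => X n le_Bn.
have [k [le_nk <-]] := filter_ex
  (filterI (nbhs_infty_ge n) (boundary_mapP phi X m)).
have [|_] := BP (initial X k) n; first by rewrite le_Bn size_initial.
by rewrite wtake_initial.
Qed.

Lemma boundary_mapM phi psi X :
  boundary_map (phi * psi) X = boundary_map phi (boundary_map psi X).
Proof.
apply: boundary_map_unique => m.
have [B BP] := aut_take phi m.
have [C CP] := boundary_map_take phi m.
have [D DP] := boundary_map_take psi (maxn B C).
exists D => // n /= le_Dn.
have eqn := DP X n le_Dn.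
have szn : (maxn B C <= size (psi (initial X n)))%N.
  rewrite -[maxn B C](size_initial (boundary_map psi X)) -eqn size_take_min.
  exact: geq_minr.
have [|_ ->] := BP (psi (initial X n)) (maxn B C).
  by rewrite leq_maxl.
have -> : wtake (maxn B C) (psi (initial X n)) =
    initial (boundary_map psi X) (maxn B C) by apply: val_inj.
by apply: CP; rewrite leq_maxr.
Qed.

Lemma boundary_mapK phi : cancel (boundary_map phi) (boundary_map phi^-1).
Proof. by move=> X; rewrite -boundary_mapM mulVg boundary_map1. Qed.

Lemma boundary_map_continuous phi : continuous (boundary_map phi).
Proof.
move=> X; have FF := fmap_filter (boundary_map phi) (nbhs_filter X).
apply/cvg_boundaryP => m; have [B BP] := boundary_map_take phi m.
apply/nbhs_boundaryP; exists B => Y; rewrite /cylinder /= size_initial => eqY.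
have := BP Y B (leqnn B); rewrite eqY => eqYB; apply: val_inj.
exact: etrans (esym eqYB) (BP X B (leqnn B)).
Qed.

(* The powers of the homeomorphism induced by phi are written as the maps
   induced by the powers of phi; see boundary_mapM. *)
Definition has_parabolic_orbit phi : Prop :=
  exists X Y, [/\ X <> Y,
    boundary_map (phi ^+ k) Y @[k --> \oo] --> X &
    boundary_map (phi ^- k) Y @[k --> \oo] --> X].

End Boundary.

(* Main.v *)
(* Let a, u, d be three basis elements, and let phi_k fix the other ones (in
   particular a), with phi_k(u) = a^k u a^k and phi_k(d) = u d.  Then
   phi_k^(n+1)(d) = a^(kn) u a^(kn) phi_k^n(d), a positive word.  The inverse has
   the same shape in the letters a, u^-1, d: it maps u^-1 to a^k u^-1 a^k and d to
   a^k u^-1 a^k d.  Hence both forward and backward iterates of the ray d d d ...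
   begin with longer and longer powers of a: they converge to a a a ...
   On the abelianization M of phi_k^p, the largest m such that M = 1 mod m is p,
   and the largest m such that (M - 1)^2 = 0 mod m is 2 k p^2.  These conjugacy
   invariants recover p and k. *)
Require Import Defs.
From mathcomp Require Import all_boot.
From mathcomp Require Import ssralg ssrint intdiv.
From mathcomp Require Import boolp classical_sets topology.
From mathcomp Require Import zify ring.

Set Implicit Arguments.
Unset Strict Implicit.
Unset Printing Implicit Defensive.

Import Algebra.
Local Open Scope group_scope.

(** * Homomorphisms out of the free group *)

Lemma free_group_ind N (P : free_group N -> Prop) :
  P 1 -> (forall a x, P x -> P (gen a * x)) -> forall x, P x.
Proof.
move=> P1 PS [w]; elim: w => [|a w IHw] wr.
  by rewrite (_ : FreeWord _ = 1) //; apply: val_inj.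
have wr' := reduced_behead wr.
rewrite (_ : FreeWord wr = gen a * FreeWord wr'); first exact: PS (IHw wr').
by apply: val_inj; rewrite /= lcons_reduced.
Qed.

Lemma gen_inv N (a : letter N) : (gen a)^-1 = gen (linv a).
Proof. exact: val_inj. Qed.

Definition lift N (G : groupType) (f : 'I_N -> G) (x : free_group N) : G :=
  \prod_(a <- word x) (if a.2 then (f a.1)^-1 else f a.1).

Lemma lift_gen N (G : groupType) (f : 'I_N -> G) i : lift f (gen (i, false)) = f i.
Proof. by rewrite /lift big_seq1. Qed.

(** Reduction only removes adjacent pairs of mutually inverse letters, and the values of such a pair
    multiply to 1. Hence [lcons] multiplies the value by that of the added letter, whether or not it
    cancels. *)
Lemma liftM N (G : groupType) (f : 'I_N -> G) : {morph lift f : x y / x * y}.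
Proof.
pose v a := if a.2 then (f a.1)^-1 else f a.1.
have vV a : v (linv a) = (v a)^-1 by case: a => i [] //=; rewrite /v /= invgK.
have vlcons a w : \prod_(b <- lcons a w) v b = v a * \prod_(b <- w) v b.
  case: w => [|b w] /=; first by rewrite big_seq1 big_nil mulg1.
  case: eqP => [->|_]; rewrite !big_cons //.
  by rewrite vV mulVKg.
move=> [u ur] [w wr]; rewrite /lift /=; elim: u {ur} => [|a u IHu] /=.
  by rewrite big_nil mul1g.
by rewrite vlcons IHu big_cons mulgA.
Qed.

Lemma morph_group1 (G H : groupType) (f : G -> H) : {morph f : x y / x * y} -> f 1 = 1.
Proof. by move=> fM; apply: (@mulgI _ (f 1)); rewrite -fM !mulg1. Qed.

Lemma morph_groupV (G H : groupType) (f : G -> H) :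
  {morph f : x y / x * y} -> {morph f : x / x^-1}.
Proof.
move=> fM x; apply: (@mulgI _ (f x)).
by rewrite -fM !mulgV (morph_group1 fM).
Qed.

Lemma morph_groupX (G H : groupType) (f : G -> H) n :
  {morph f : x y / x * y} -> {morph f : x / x ^+ n}.
Proof.
move=> fM x; elim: n => [|n IHn]; first by rewrite !expg0 (morph_group1 fM).
by rewrite !expgS fM IHn.
Qed.

Lemma morph_free_ext N (G : groupType) (f g : free_group N -> G) :
  {morph f : x y / x * y} -> {morph g : x y / x * y} ->
  (forall i, f (gen (i, false)) = g (gen (i, false))) -> f =1 g.
Proof.
move=> fM gM fg; apply: free_group_ind; first by rewrite !morph_group1.
move=> [i b] x IHx; rewrite fM gM IHx; congr (_ * _).
case: b; last exact: fg.
by rewrite -(gen_inv (i, false)) !morph_groupV // fg.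
Qed.

(** The hypotheses say that the two extensions compose to the identity on the basis in both orders;
    a homomorphism is determined there, so they are mutually inverse. *)
Lemma lift_aut N (f g : 'I_N -> free_group N) :
  (forall i, lift f (g i) = gen (i, false)) ->
  (forall i, lift g (f i) = gen (i, false)) ->
  exists phi : aut (free_group N), forall i, phi (gen (i, false)) = f i.
Proof.
move=> fg gf.
have phiP : `[< {morph lift f : x y / x * y} /\ bijective (lift f) >].
  apply/asboolP; split; first exact: liftM.
  exists (lift g).
    by apply: (morph_free_ext (f := lift g \o lift f)) => // [x y|i] /=;
      rewrite ?liftM // lift_gen gf.
  by apply: (morph_free_ext (f := lift f \o lift g)) => // [x y|i] /=;
    rewrite ?liftM // lift_gen fg.
by exists (MkAut phiP) => i; rewrite /= lift_gen.
Qed.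

(** * The twist automorphisms *)

Lemma twist_aut N (a u d : 'I_N) k : u != a -> d != a -> d != u ->
  exists phi : aut (free_group N),
  [/\ phi (gen (u, false)) = gen (a, false) ^+ k * gen (u, false) * gen (a, false) ^+ k,
      phi (gen (d, false)) = gen (u, false) * gen (d, false) &
      forall i, i != u -> i != d -> phi (gen (i, false)) = gen (i, false)].
Proof.
move=> ua da du; pose x i : free_group N := gen (i, false).
pose f i : free_group N := if i == u then x a ^+ k * x u * x a ^+ k
            else if i == d then x u * x d else x i.
(* The inverse is found by solving for the basis: [u] is the image of [a^-k u a^-k], so [d] must
   come from [(a^-k u a^-k)^-1 d], which is [a^k u^-1 a^k d]. *)
pose g i : free_group N := if i == u then x a ^- k * x u * x a ^- k
            else if i == d then x a ^+ k * (x u)^-1 * x a ^+ k * x d else x i.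
have fa : f a = x a by rewrite /f !(eq_sym a) (negPf ua) (negPf da).
have ga : g a = x a by rewrite /g !(eq_sym a) (negPf ua) (negPf da).
have fu : f u = x a ^+ k * x u * x a ^+ k by rewrite /f eqxx.
have gu : g u = x a ^- k * x u * x a ^- k by rewrite /g eqxx.
have fd : f d = x u * x d by rewrite /f (negPf du) eqxx.
have gd : g d = x a ^+ k * (x u)^-1 * x a ^+ k * x d by rewrite /g (negPf du) eqxx.
have LE (h : 'I_N -> free_group N) := (liftM h, morph_groupV (liftM h),
  morph_groupX k (liftM h), lift_gen h).
have [||phi phiE] := lift_aut (f := f) (g := g).
- move=> i; rewrite {1}/g; case: eqP => [->|/eqP iu].
    by rewrite !LE fa fu !mulgA mulVg mul1g mulgK.
  case: eqP => [->|/eqP id]; last by rewrite lift_gen /f (negPf iu) (negPf id).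
  by rewrite !LE fa fu fd !invgM !mulgA mulgV mul1g mulgVK mulVg mul1g.
- move=> i; rewrite {1}/f; case: eqP => [->|/eqP iu].
    by rewrite !LE ga gu !mulgA mulgV mul1g mulgVK.
  case: eqP => [->|/eqP id]; last by rewrite lift_gen /g (negPf iu) (negPf id).
  by rewrite !LE gu gd !mulgA mulgVK mulgK mulVg mul1g.
exists phi; split; rewrite ?phiE // => i iu id.
by rewrite phiE /f (negPf iu) (negPf id).
Qed.

(** * Products without cancellation *)

Definition sign_pattern N (s : 'I_N -> bool) (x : free_group N) :=
  all (fun a : letter N => a.2 == s a.1) (word x).

(** With one sign fixed per basis element, a letter and its inverse never both occur, so nothing
    cancels at the junction. These are the positive words after inverting the basis elements
    selected by [s]. *)
Lemma sign_patternM_word N (s : 'I_N -> bool) (x y : free_group N) :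
  sign_pattern s x -> sign_pattern s y -> word (x * y) = word x ++ word y.
Proof.
rewrite /sign_pattern => + yP; rewrite /=; case: x => x _ /=.
elim: x => //= a x IHx /andP[aP xP]; rewrite IHx // /lcons.
have : all (fun a : letter N => a.2 == s a.1) (x ++ y) by rewrite all_cat xP.
case: (x ++ y) => //= b w /andP[bP _]; case: eqP => // ba.
by move: bP; rewrite ba /= -(eqP aP); case: (a.2).
Qed.

Lemma sign_patternM N (s : 'I_N -> bool) (x y : free_group N) :
  sign_pattern s x -> sign_pattern s y -> sign_pattern s (x * y).
Proof.
by move=> xP yP; rewrite /sign_pattern (sign_patternM_word xP yP) all_cat; apply/andP.
Qed.

Lemma sign_patternX N (s : 'I_N -> bool) (x : free_group N) n :
  sign_pattern s x -> sign_pattern s (x ^+ n).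
Proof. by move=> xP; elim: n => // n IHn; rewrite expgS sign_patternM. Qed.

Lemma sign_pattern_gen N (s : 'I_N -> bool) (a : letter N) :
  sign_pattern s (gen a) = (a.2 == s a.1).
Proof. by rewrite /sign_pattern /= andbT. Qed.

(** * Constant rays and limits of iterates on the boundary *)

Lemma no_cancel_refl N : reflexive (@no_cancel N).
Proof. by case=> i b; apply/eqP => -[]; case: b. Qed.

Lemma word_genX N (a : letter N) n : word (gen a ^+ n) = nseq n a.
Proof.
elim: n => // n IHn; rewrite expgS /= IHn lcons_reduced //.
by rewrite /reduced /=; elim: n {IHn} => //= n ->; rewrite no_cancel_refl.
Qed.

Fact const_ray_subproof N (a : letter N) :
  `[< forall n : nat, no_cancel ((fun=> a) n) ((fun=> a) n.+1) >].
Proof. by apply/asboolP => _; apply: no_cancel_refl. Qed.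

Definition const_ray N (a : letter N) : boundary N :=
  MkBoundary (const_ray_subproof a).

Lemma initial_const_ray N (a : letter N) n : initial (const_ray a) n = gen a ^+ n.
Proof.
apply: val_inj; rewrite /= word_genX.
by elim: n => // n IHn; rewrite -[in RHS]addn1 nseqD -IHn mkseqS -cats1.
Qed.

(** The parameter [j] covers both time directions at once: [j = 0] for a twist, and [j = k] for its
    inverse, with [u] replaced by its inverse letter. *)
Lemma twist_cvg N (psi : aut (free_group N)) (a u d : letter N) (s : 'I_N -> bool) j k :
  a.2 = s a.1 -> u.2 = s u.1 -> d.2 = s d.1 -> (0 < k)%N ->
  psi (gen a) = gen a ->
  psi (gen u) = gen a ^+ k * gen u * gen a ^+ k ->
  psi (gen d) = gen a ^+ j * gen u * gen a ^+ j * gen d ->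
  (boundary_map (psi ^+ n) (const_ray d) @[n --> \oo] --> const_ray a)%classic.
Proof.
move=> aP uP dP k_gt0 psia psiu psid.
have psiS n x : (psi ^+ n.+1) x = (psi ^+ n) (psi x) by rewrite expgSr.
have psiM n := autM (psi ^+ n).
have psina n : (psi ^+ n) (gen a) = gen a.
  by elim: n => // n IHn; rewrite psiS psia.
have psinX n i : (psi ^+ n) (gen a ^+ i) = gen a ^+ i.
  by rewrite morph_groupX // psina.
have psinu n : (psi ^+ n) (gen u) = gen a ^+ (k * n) * gen u * gen a ^+ (k * n).
  elim: n => [|n IHn]; first by rewrite muln0 !expg0 mul1g mulg1.
  by rewrite psiS psiu !psiM IHn psinX !mulgA -expgnDr -!mulgA -expgnDr mulnS
    [(k * n + k)%N]addnC.
(* What follows the leading power of [a] in the iterate of [d]. It has sign pattern [s], so it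
   cannot erode that power. *)
pose w n := gen u * gen a ^+ (k * n) * gen a ^+ j * (psi ^+ n) (gen d).
have psind n : (psi ^+ n.+1) (gen d) = gen a ^+ (j + k * n) * w n.
  by rewrite psiS psid !psiM psinu psinX /w expgnDr !mulgA.
have aX i : sign_pattern s (gen a ^+ i).
  by rewrite sign_patternX // sign_pattern_gen aP.
have wdP n : sign_pattern s (w n) /\ sign_pattern s ((psi ^+ n) (gen d)).
  have wP i : sign_pattern s ((psi ^+ i) (gen d)) -> sign_pattern s (w i).
    by move=> dnP; rewrite /w !sign_patternM // sign_pattern_gen uP.
  suff dnP : sign_pattern s ((psi ^+ n) (gen d)) by split=> //; apply: wP.
  elim: n => [|n IHn]; first by rewrite sign_pattern_gen dP.
  by rewrite psind sign_patternM // wP.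
(* Past [m.+1] the exponent is a successor [n.+1] with [m <= n]; since [k > 0], the leading power
   [a^(j + k n)] then covers the first [m] letters. *)
apply/cvg_boundaryP => m; exists m.+1 => // -[//|n] /= lt_mn.
(* The image ray is read off from the image of [d^i] for large [i]; [1 <= i] allows one factor [d]
   to be split off, which supplies the leading power of [a]. *)
have [i [le_1i eqi]] := filter_ex (filterI (nbhs_infty_ge 1%N)
  (boundary_mapP (psi ^+ n.+1) (const_ray d) m)).
case: i le_1i eqi => // i _ eqi; apply: val_inj; apply: etrans (esym eqi) _.
rewrite -[RHS]/(word (initial (const_ray a) m)) !initial_const_ray word_genX.
rewrite (expgS (gen d)) psiM morph_groupX // {1}psind -mulgA.
have [wP _] := wdP n; have [_ dP'] := wdP n.+1.
have le_mk : (m <= j + k * n)%N by nia.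
have wdP' : sign_pattern s (w n * (psi ^+ n.+1) (gen d) ^+ i).
  by apply: sign_patternM wP _; apply: sign_patternX.
rewrite (sign_patternM_word (aX _) wdP') word_genX.
by rewrite takel_cat ?size_nseq // take_nseq.
Qed.

Lemma twist_parabolic N (phi : aut (free_group N)) (a u d : 'I_N) k :
  u != a -> d != a -> d != u -> (0 < k)%N ->
  phi (gen (a, false)) = gen (a, false) ->
  phi (gen (u, false)) = gen (a, false) ^+ k * gen (u, false) * gen (a, false) ^+ k ->
  phi (gen (d, false)) = gen (u, false) * gen (d, false) ->
  has_parabolic_orbit phi.
Proof.
move=> ua da du k_gt0 phia phiu phid.
exists (const_ray (a, false)), (const_ray (d, false)); split.
- move=> /(congr1 (fun X : boundary N => (X 0%N).1)) /eqP /=.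
  by rewrite eq_sym (negPf da).
- apply: (@twist_cvg _ _ _ (u, false) _ (fun=> false) 0 k) => //.
(* For backward time, the inverse twist has the same form in the letters [a], [u^-1], [d], so only
   [u] carries the negative sign. *)
pose s i := i == u.
have phiV x y : x = phi y -> phi^-1 x = y by move=> ->; rewrite autK.
rewrite (_ : (fun n => _) =
    fun n => boundary_map (phi^-1 ^+ n) (const_ray (d, false))); last first.
  by apply: funext => n; rewrite expVgn.
apply: (@twist_cvg _ _ _ (u, true) _ s k k) => //=.
- by rewrite /s eq_sym (negPf ua).
- by rewrite /s eqxx.
- by rewrite /s (negPf du).
- exact: phiV.
- apply: phiV; rewrite !autM -(gen_inv (u, false)) (morph_groupV (autM phi)).
  rewrite !(morph_groupX _ (autM phi)) phia phiu !invgM !mulgA mulgV mul1g.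
  by rewrite mulgVK.
apply: phiV; rewrite !autM -(gen_inv (u, false)) (morph_groupV (autM phi)).
rewrite !(morph_groupX _ (autM phi)) phia phiu phid !invgM !mulgA mulgV mul1g.
by rewrite mulgVK mulVg mul1g.
Qed.

(** * Conjugacy invariants from the abelianization *)

Definition additive_character N (chi : free_group N -> int) :=
  {morph chi : x y / x * y >-> (x + y)%R}.

(** The coordinate functions of the abelianization, serving as test characters that read off matrix
    entries. *)
Definition exponent_sum N (i : 'I_N) (x : free_group N) : int :=
  (\sum_(a <- word x) (if a.1 == i then (-1) ^+ a.2 else 0))%R.

Lemma exponent_sum_additive N (i : 'I_N) : additive_character (exponent_sum i).
Proof.
pose v (a : letter N) : int := (if a.1 == i then (-1) ^+ a.2 else 0)%R.
have vlcons a w : (\sum_(b <- lcons a w) v b = v a + \sum_(b <- w) v b)%R.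
  case: w => [|b w] /=; first by rewrite big_seq1 big_nil GRing.addr0.
  case: eqP => [->|_]; rewrite !big_cons // /v /=.
  by case: ifP => _; case: (a.2) => /=; ring.
move=> [u ur] [w wr]; rewrite /exponent_sum /=; elim: u {ur} => [|a u IHu] /=.
  by rewrite big_nil GRing.add0r.
by rewrite vlcons IHu big_cons GRing.addrA.
Qed.

Lemma exponent_sum_gen N (i j : 'I_N) : exponent_sum i (gen (j, false)) = Posz (j == i).
Proof. by rewrite /exponent_sum big_seq1 /=; case: eqP. Qed.

Lemma additive_character1 N (chi : free_group N -> int) :
  additive_character chi -> chi 1 = 0%R.
Proof.
move=> chiM; apply: (@GRing.addrI _ (chi 1)).
by rewrite -chiM mulg1 GRing.addr0.
Qed.

Lemma additive_characterX N (chi : free_group N -> int) x n :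
  additive_character chi -> chi (x ^+ n) = (n%:Z * chi x)%R.
Proof.
move=> chiM; elim: n => [|n IHn]; first by rewrite expg0 additive_character1 // GRing.mul0r.
by rewrite expgS chiM IHn -addn1 PoszD; ring.
Qed.

Lemma dvdz_additive_character N (chi : free_group N -> int) (m : int) :
  additive_character chi -> (forall i, m %| chi (gen (i, false)))%Z ->
  forall x, (m %| chi x)%Z.
Proof.
move=> chiM mchi; apply: free_group_ind; first by rewrite additive_character1 ?dvdz0.
move=> [i b] x mx; rewrite chiM GRing.rpredD //; case: b; last exact: mchi.
rewrite -(gen_inv (i, false)); set y := gen _.
have /eqP : chi (y * y^-1) = 0%R by rewrite mulgV additive_character1.
by rewrite chiM GRing.addrC GRing.addr_eq0 => /eqP ->; rewrite GRing.rpredN; apply: mchi.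
Qed.

(* The polynomial with coefficients c, evaluated at the action of phi on the
   abelianization Z^N, vanishes modulo m. *)
Definition annihilates_mod N (m : int) (c : seq int) (phi : aut (free_group N)) :=
  forall chi, additive_character chi -> forall x,
  (m %| (\sum_(i < size c) c`_i * chi ((phi ^+ i)%g x))%R)%Z.

(** Characters are permuted by automorphisms: testing [psi] with [chi] at [x] amounts to testing
    [phi] with [chi \o z^-1] at [z x]. *)
Lemma annihilates_mod_conjugate N m c (phi psi : aut (free_group N)) :
  conjugate phi psi -> annihilates_mod m c phi -> annihilates_mod m c psi.
Proof.
move=> [z <-] phiP chi chiM x.
have chizM : additive_character (chi \o z^-1) by move=> y1 y2 /=; rewrite autM chiM.
have := phiP _ chizM (z x); congr (_ %| _)%Z.
by apply: eq_bigr => i _; rewrite -conjXg.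
Qed.

(** For fixed [chi] the tested sum is itself an additive character in [x], so divisibility on the
    basis is enough. *)
Lemma annihilates_mod_gens N m c (phi : aut (free_group N)) :
  annihilates_mod m c phi <-> forall chi, additive_character chi -> forall i,
  (m %| (\sum_(j < size c) c`_j * chi ((phi ^+ j)%g (gen (i, false))))%R)%Z.
Proof.
split=> [phiP chi chiM i|phiP chi chiM]; first exact: phiP.
apply: dvdz_additive_character => [x y|]; last exact: phiP.
by rewrite -big_split; apply: eq_bigr => i _; rewrite /= autM chiM GRing.mulrDr.
Qed.

(** Each step adds [2 k a] to [u] and [u] to [d]; the quadratic term is the sum of [2 k i] over
    [i < n]. *)
Lemma twist_characterX N (phi : aut (free_group N)) (a u d : 'I_N) k :
  phi (gen (a, false)) = gen (a, false) ->
  phi (gen (u, false)) = gen (a, false) ^+ k * gen (u, false) * gen (a, false) ^+ k ->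
  phi (gen (d, false)) = gen (u, false) * gen (d, false) ->
  forall n chi, additive_character chi ->
  [/\ chi ((phi ^+ n) (gen (a, false))) = chi (gen (a, false)),
      chi ((phi ^+ n) (gen (u, false))) =
        (chi (gen (u, false)) + 2 * k%:Z * n%:Z * chi (gen (a, false)))%R &
      chi ((phi ^+ n) (gen (d, false))) =
        (chi (gen (d, false)) + n%:Z * chi (gen (u, false)) +
         k%:Z * n%:Z * (n%:Z - 1) * chi (gen (a, false)))%R].
Proof.
move=> phia phiu phid n chi chiM; elim: n => [|n [IHa IHu IHd]].
  by rewrite expg0 !aut1E; split=> //; ring.
rewrite expgSr !autME phia phiu phid !autM !(morph_groupX _ (autM (phi ^+ n))).
rewrite !chiM !additive_characterX // IHa IHu IHd -[n.+1]addn1 PoszD.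
by split=> //; ring.
Qed.

(** The coefficient lists, constant term first, are those of [X - 1] and [(X - 1)^2]. For the matrix
    [M] of [phi ^+ p], [M - 1] sends [u] to [2 k p a] and [d] to [p u + k p (p - 1) a]; its square
    sends [d] to [2 k p^2 a] and kills the other basis elements. *)
Lemma twist_annihilates_mod N (phi : aut (free_group N)) (a u d : 'I_N) k :
  u != a -> d != a -> d != u ->
  phi (gen (u, false)) = gen (a, false) ^+ k * gen (u, false) * gen (a, false) ^+ k ->
  phi (gen (d, false)) = gen (u, false) * gen (d, false) ->
  (forall i, i != u -> i != d -> phi (gen (i, false)) = gen (i, false)) ->
  forall p (m : int),
  (annihilates_mod m [:: -1; 1]%R (phi ^+ p) <-> (m %| Posz p)%Z) /\
  (annihilates_mod m [:: 1; -2; 1]%R (phi ^+ p) <-> (m %| Posz (2 * k * p ^ 2)%N)%Z).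
Proof.
move=> ua da du phiu phid phii p m.
have phia : phi (gen (a, false)) = gen (a, false) by rewrite phii // eq_sym.
have E n chi (chiM : additive_character chi) := twist_characterX phia phiu phid n chiM.
have Ei n i : i != u -> i != d -> (phi ^+ n) (gen (i, false)) = gen (i, false).
  by move=> iu id; elim: n => // n IHn; rewrite expgSr autME phii.
have ind (P : 'I_N -> Prop) : P u -> P d -> (forall i, i != u -> i != d -> P i) ->
    forall i, P i.
  by move=> Pu Pd PP i; have [->//|iu] := eqVneq i u; have [->//|id] := eqVneq i d; apply: PP.
split; rewrite annihilates_mod_gens;
  split => [/(_ _ (exponent_sum_additive _) d) H|mP chi chiM].
(* The [u]-coordinate of [(M - 1) d] is exactly [p]. *)
- have := H u; rewrite !big_ord_recr big_ord0 /= expg1.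
  have [_ _ ->] := E p _ (exponent_sum_additive u).
  rewrite !exponent_sum_gen eqxx (negPf du) eq_sym (negPf ua).
  rewrite /=; congr (is_true (_ %| _)%Z); ring.
- move=> i; rewrite !big_ord_recr big_ord0 /= expg1.
  have [_ Eu Ed] := E p _ chiM.
  move: i; apply: ind => [||i iu id]; rewrite ?Eu ?Ed ?Ei //.
  + rewrite (_ : (_ + _)%R = (p%:Z * (2 * k%:Z * chi (gen (a, false))))%R) ?dvdz_mulr //; ring.
  + rewrite (_ : (_ + _)%R = (p%:Z * (chi (gen (u, false)) +
      k%:Z * (p%:Z - 1) * chi (gen (a, false))))%R) ?dvdz_mulr //; ring.
  + rewrite (_ : (_ + _)%R = 0%R) ?dvdz0 //; ring.
(* The [a]-coordinate of [(M - 1)^2 d] is exactly [2 k p^2]. *)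
- have := H a; rewrite !big_ord_recr big_ord0 /= expg1 -autME -expgnDr.
  have [_ _ ->] := E p _ (exponent_sum_additive a).
  have [_ _ ->] := E (p + p)%N _ (exponent_sum_additive a).
  rewrite !exponent_sum_gen eqxx (negPf da) (negPf ua).
  rewrite /=; congr (is_true (_ %| _)%Z); rewrite ?PoszD !PoszM; ring.
- move=> i; rewrite !big_ord_recr big_ord0 /= expg1 -autME -expgnDr.
  have [_ Eu Ed] := E p _ chiM; have [_ Eu2 Ed2] := E (p + p)%N _ chiM.
  move: i; apply: ind => [||i iu id]; rewrite ?Eu ?Ed ?Eu2 ?Ed2 ?Ei // ?PoszD.
  + rewrite (_ : (_ + _)%R = 0%R) ?dvdz0 //; ring.
  + rewrite (_ : (_ + _)%R = ((2 * k * p ^ 2)%N%:Z * chi (gen (a, false)))%R) ?dvdz_mulr //.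
    by rewrite ?PoszD !PoszM; ring.
  + rewrite (_ : (_ + _)%R = 0%R) ?dvdz0 //; ring.
Qed.

(** * Recovering the exponent and the index of a power *)

Theorem theorem1p1 (N : nat) (hN : (4 <= N)%N) :
  exists phi : nat -> aut (free_group N),
    (forall k : nat, (0 < k)%N -> has_parabolic_orbit (phi k)) /\
    (forall k k' p p' : nat,
       (0 < k)%N -> (0 < k')%N -> (0 < p)%N -> (0 < p')%N ->
       (conjugate (phi k ^+ p) (phi k' ^+ p') <-> k = k' /\ p = p')).
Proof.
have lt2N : (2 < N)%N by apply: ltn_trans hN.
pose a := Ordinal (ltn_trans (isT : 0 < 2)%N lt2N).
pose u := Ordinal (ltn_trans (isT : 1 < 2)%N lt2N).
pose d := Ordinal lt2N.
have [ua da du] : [/\ u != a, d != a & d != u] by [].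
have [phi phiP] := choice (fun k => twist_aut k ua da du).
exists phi; split=> [k k_gt0|k k' p p' k_gt0 k'_gt0 p_gt0 p'_gt0].
  have [phiu phid phii] := phiP k.
  by apply: twist_parabolic ua da du k_gt0 _ phiu phid; rewrite phii // eq_sym.
have Phi j := let: And3 phiu phid phii := phiP j in
  twist_annihilates_mod ua da du phiu phid phii.
split=> [|[<- <-]]; last by exists 1; rewrite conjg1.
(* Taking the first automorphism's own invariants as moduli transfers them to the second as
   divisibilities; conjugacy is symmetric, so both directions together give equalities. *)
have dvd k1 k2 p1 p2 : conjugate (phi k1 ^+ p1) (phi k2 ^+ p2) ->
    (p1 %| p2)%N /\ (2 * k1 * p1 ^ 2 %| 2 * k2 * p2 ^ 2)%N.
  move=> conj12; split.
    have [ann1 _] := Phi k1 p1 p1; have [ann2 _] := Phi k2 p2 p1.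
    exact/ann2/(annihilates_mod_conjugate conj12)/ann1/dvdzz.
  have [_ ann1] := Phi k1 p1 (2 * k1 * p1 ^ 2)%N.
  have [_ ann2] := Phi k2 p2 (2 * k1 * p1 ^ 2)%N.
  exact/ann2/(annihilates_mod_conjugate conj12)/ann1/dvdzz.
move=> conj12; have [dvdp dvdk] := dvd _ _ _ _ conj12.
have [|dvdp' dvdk'] := dvd k' k p' p.
  by case: conj12 => z <-; exists z^-1; rewrite conjgK.
have pp' : p = p' by apply/eqP; rewrite eqn_dvd dvdp.
split=> //; have /eqP : (2 * k * p ^ 2)%N = (2 * k' * p ^ 2)%N.
  by apply/eqP; rewrite eqn_dvd {2 3}pp' dvdk dvdk'.
by rewrite eqn_pmul2r ?expn_gt0 ?p_gt0 // eqn_pmul2l // => /eqP.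
Qed.
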